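(* For every integer $n\ge 1$ there is a palindromic and monic polynomial $P_n$ of degree $2n-2$ with integer coefficients such that, for all integers $q\ge 2$, $$\zeta_q(n)=\frac{q}{(q-1)^{2n-1}(q+1)^n}\,P_n(q).$$ Moreover, the coefficients of $P_n$ count weighted $2$-coloured Dyck words: for every integer $k\ge 0$, the coefficient of $t^k$ in $P_n(t)$ is the number of $2$-coloured Dyck words $w$ of length $2n-2$ with weight $h(w)=k$. In particular, the coefficients of $P_n$ are non-negative.
   Context: **Spectral zeta function.** For an integer $q\ge 2$, let $T_{q+1}$ be the regular tree of degree $q+1$, with adjacency operator $A$, combinatorial Laplacian $\Delta_q=(q+1)-A$ acting on $\ell^2(T_{q+1})$, and a fixed vertex $\mathbf 0$. The spectral zeta function of $T_{q+1}$ is the entire function $$\zeta_q(s)=\langle \Delta_q^{-s}\delta_{\mathbf 0}\mid\delta_{\mathbf 0}\rangle=\frac{q+1}{2\pi}\int_{-2\sqrt q}^{2\sqrt q}(q+1-\lambda)^{-s}\,\frac{\sqrt{4q-\lambda^2}}{(q+1)^2-\lambda^2}\,\mathrm d\lambda ,\qquad s\in\mathbb C.$$ **Palindromic.** A polynomial $P$ of degree $d$ is palindromic if $x^{d}P(1/x)=P(x)$. **$2$-coloured Dyck words.** Consider words in the letters $U,B,R$. Reading a word from left to right, associate to it a path starting at $(0,0)\in\mathbb Z^2$: each $U$ is a step $(1,1)$, and each $B$ (blue) or $R$ (red) is a step $(1,-1)$. The word is a $2$-coloured Dyck word if the path never goes below the horizontal axis and ends on it. The empty word is a $2$-coloured Dyck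 word, of length $0$. For $\beta\in\{U,B,R\}$, a block of colour $\beta$ in a word $w$ is a maximal non-empty subword of consecutive letters all equal to $\beta$; let $r_\beta(w)$ be the number of blocks of colour $\beta$ in $w$. The weight of a $2$-coloured Dyck word $w$ of length $2m$ is $$h(w)=m+r_B(w)-r_R(w).$$ *)

(* Defs.v *)
From HB Require Import structures.
From mathcomp Require Import all_boot all_order all_algebra.
From mathcomp Require Import all_classical all_reals all_analysis.
From mathcomp Require Import complex.

Set Implicit Arguments.
Unset Strict Implicit.
Unset Printing Implicit Defensive.

Import Order.TTheory GRing.Theory Num.Theory.
Import numFieldNormedType.Exports.

Local Open Scope ring_scope.

Section SpectralZeta.
Variable R : realType.
Local Open Scope complex_scope.

Definition cexp (z : R[i]) : R[i] :=
  (expR (complex.Re z))%:C * (cos (complex.Im z) +i* sin (complex.Im z)).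

(* Principal value; only meaningful for x > 0. *)
Definition cpow (x : R) (s : R[i]) : R[i] := cexp (s * (ln x)%:C).

Definition cintegral (D : set R) (f : R -> R[i]) : R[i] :=
  (\int[lebesgue_measure]_(x in D) complex.Re (f x))
    +i* (\int[lebesgue_measure]_(x in D) complex.Im (f x)).

(* <Delta_q^{-s} delta_0 | delta_0> on the (q+1)-regular tree, written with the
   spectral measure of the adjacency operator at a vertex (Kesten-McKay). For
   q >= 2 one has q + 1 - lam > 0 on the domain, since q + 1 > 2 sqrt q. *)
Definition zeta (q : nat) (s : R[i]) : R[i] :=
  ((q%:R + 1) / (2 * pi))%:C *
  cintegral `[- (2 * Num.sqrt q%:R), 2 * Num.sqrt q%:R]%classic
    (fun lam : R => cpow (q%:R + 1 - lam) (- s) *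
       (Num.sqrt (4 * q%:R - lam ^+ 2) / ((q%:R + 1) ^+ 2 - lam ^+ 2))%:C).

End SpectralZeta.

(* x^d P(1/x) = P(x) as rational functions, i.e. at every nonzero rational x,
   where d = (size P).-1 is the degree of P. *)
Definition palindromic (P : {poly int}) : Prop :=
  forall x : rat, x != 0 ->
    x ^+ (size P).-1 * (map_poly intr P).[x^-1] = (map_poly intr P).[x].

Inductive letter : Type := Up | Blue | Red.

Definition letter_to_ord (a : letter) : 'I_3 :=
  match a with Up => inord 0 | Blue => inord 1 | Red => inord 2 end.
Definition letter_of_ord (i : 'I_3) : letter :=
  match val i with 0 => Up | 1 => Blue | _ => Red end.
Lemma letter_to_ordK : cancel letter_to_ord letter_of_ord.
Proof. by case; rewrite /letter_of_ord /= inordK. Qed.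

HB.instance Definition _ := Finite.copy letter (can_type letter_to_ordK).

Definition step (a : letter) : int := if a is Up then 1 else -1.

Definition height (w : seq letter) : int := \sum_(a <- w) step a.

Definition dyck2 (w : seq letter) : bool :=
  [forall i : 'I_(size w).+1, 0 <= height (take i w)] && (height w == 0).

(* A subword of w is given by positions i <= j: it consists of the letters at
   positions i, ..., j - 1. *)
Definition monochrome (b : letter) (w : seq letter) (i j : nat) : bool :=
  (i < j)%N && all (pred1 b) (drop i (take j w)).

Definition is_block (b : letter) (w : seq letter)
    (i j : 'I_(size w).+1) : bool :=
  monochrome b w i j &&
  [forall i' : 'I_(size w).+1, forall j' : 'I_(size w).+1,
     [&& (i' <= i)%N, (j <= j')%N & monochrome b w i' j']
       ==> (i' == i) && (j' == j)].

Definition nblocks (b : letter) (w : seq letter) : nat :=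
  #|[set p : 'I_(size w).+1 * 'I_(size w).+1 | is_block b p.1 p.2]|.

Definition weight (w : seq letter) : int :=
  ((size w)./2)%:Z + (nblocks Blue w)%:Z - (nblocks Red w)%:Z.

Definition num_dyck2 (m k : nat) : nat :=
  #|[set w : (2 * m).-tuple letter | dyck2 w && (weight w == k%:Z)]|.

(* Main.v *)
Require Import Defs.
From HB Require Import structures.
From mathcomp Require Import all_boot all_order all_algebra.
From mathcomp Require Import all_classical all_reals all_analysis.
From mathcomp Require Import complex.
From mathcomp Require Import zify ring lra.

Set Implicit Arguments.
Unset Strict Implicit.
Unset Printing Implicit Defensive.

Import Order.TTheory GRing.Theory Num.Theory.
Local Open Scope ring_scope.

(** Write [p = q - 1], [a = q + 1], [c = p^2 a].  At an integer [s = n], the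
zeta value is an integral of a rational function against the semicircle density
[sqrt (4q - x^2)] on [[-2 sqrt q, 2 sqrt q]], and partial fractions
([mixed_integralS]) reduce it to the moments
[I_n = \int sqrt (4q - x^2) / (a - x)^n dx].
Differentiating [(4q - x^2)^(3/2) / (a - x)^n] gives a three-term recurrence for
the [I_n] ([resolvent_integral_rec]); [I_0 = 2 pi q] and [I_1 = 2 pi] come from
explicit primitives.

On the combinatorial side let [t] mark the weight and [y] the half-length, and
let [D(y)] be the generating function of 2-coloured Dyck words.  Splitting a word
at its last return to the axis gives linear equations for the words ending in
[Blue] and in [Red]; eliminating these two series leaves
[[
  D - 2 t y D^2 = 1 + (t - 1)^2 y D - t (t - 1)^2 y^2 D^2
]]
([dyck_gf_quadratic]).  The splitting itself is never performed on words: paths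
that end at height [h] satisfy a linear recurrence in their length, obtained by
removing the last letter, and the products [D^h * _] satisfy the same one.

The two sides meet as follows.  Put [t = q], [Z = 1 + q p y D],
[G = Z (2 - p^2 y) - 1] and [S = a - c y - 2 G].  The quadratic equation for
[D] says exactly that [S^2 = (a - c y)^2 - 4 q]: [S] is the square root of a
quadratic polynomial [Q].  Hence [2 Q S' = Q' S], which is a three-term recurrence
for the coefficients of [G], and it is the one satisfied by
[c^n I_{n+1} / (2 pi)].  Unwinding the partial fractions, the coefficient of
[y^n] in [Z] is [c^n zeta_q(n)], which is the announced formula
([moments_dyck]).

The polynomial [P_n] is the generating polynomial of the Dyck words of length
[2n - 2]; that it is palindromic reflects the exchange of the two colours
([path_gf_swap]), and it is monic because [(U B)^(n-1)] is the only word of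
maximal weight ([lead_dyck_gf]). *)

(** * Blocks and weights as statistics read from left to right *)

(** Equality on [letter] is transported from ['I_3] and does not compute. *)
Lemma letter_eqE :
  ((Up == Blue = false) * (Up == Red = false) * (Blue == Up = false) *
   (Blue == Red = false) * (Red == Up = false) * (Red == Blue = false))%type.
Proof. by do !split; apply/eqP. Qed.

(** The letter [s] precedes [w], so that the statistic is computed letter
by letter; [s = Up] stands for the beginning of the word. *)
Definition colour_starts (b : letter) (s : letter) (w : seq letter) : nat :=
  \sum_(i < size w) ((nth Up w i == b) && (nth Up (s :: w) i != b)).

Lemma monochromeP (b : letter) (w : seq letter) (i j : nat) :
  (j <= size w)%N ->
  reflect ((i < j)%N /\ forall k, (i <= k < j)%N -> nth Up w k = b)
          (monochrome b w i j).
Proof.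
move=> jw; have sz : size (take j w) = j by rewrite size_takel.
apply: (iffP andP) => -[ij H]; split=> //.
- move=> k /andP[ik kj]; apply/eqP; move/all_nthP: H => /(_ Up (k - i)%N).
  by rewrite size_drop sz nth_drop subnKC // nth_take //= ; apply; rewrite ltn_sub2r.
- apply/(all_nthP Up) => k; rewrite size_drop sz => kji.
  rewrite nth_drop nth_take /= ?H //; lia.
Qed.

(** A block is determined by its first position, and a position starts a block of
colour [b] as soon as it carries [b] and the previous one does not: the block then
extends up to the next letter different from [b]. *)
Lemma nblocks_starts (b : letter) (w : seq letter) :
  b != Up -> nblocks b w = colour_starts b Up w.
Proof.
move=> bU.
have startE (i : 'I_(size w)) : (nth Up (Up :: w) i != b) =
    ((i == 0 :> nat) || (nth Up w i.-1 != b)).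
  by case: i => -[|i] //= _; rewrite eq_sym.
pose fstm (p : 'I_(size w).+1 * 'I_(size w).+1) := p.1.
pose S := [set i : 'I_(size w).+1 | [&& (i < size w)%N, nth Up w i == b
   & (i == 0 :> nat) || (nth Up w i.-1 != b)]].
have jle (j : 'I_(size w).+1) : (j <= size w)%N by rewrite -ltnS.
have inj : {in [set p | is_block b p.1 p.2] &, injective fstm}.
  move=> [i j] [i' j'] /[!inE] /= /andP[m1 /forallP M1] /andP[m2 /forallP M2].
  rewrite /fstm /= => ii'; subst i'.
  have [jj|jj] := leqP j j'.
    move: (M1 i) => /forallP /(_ j'); rewrite leqnn jj m2 /= => /andP[_ /eqP ->].
    by [].
  move: (M2 i) => /forallP /(_ j); rewrite leqnn (ltnW jj) m1 /= => /andP[_ /eqP ->].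
  by [].
rewrite /nblocks -(card_in_imset inj).
have -> : fstm @: [set p | is_block b p.1 p.2] = S.
  apply/setP => i; rewrite inE; apply/imsetP/idP.
  - case=> -[i' j] /[!inE] /= /andP[/(monochromeP _ _ (jle j)) [ij H] /forallP M].
    rewrite /fstm /= => -> {i}.
    have iw : (i' < size w)%N by rewrite (leq_trans ij).
    rewrite iw H ?leqnn ?ij // eqxx /=.
    case: (posnP i') => //= i0; apply/negP => /eqP Hp.
    have lt : (i'.-1 < (size w).+1)%N by lia.
    move: (M (Ordinal lt)) => /forallP /(_ j) /=.
    rewrite leq_pred leqnn /= => M'.
    have M1 : monochrome b w i'.-1 j.
      apply/(monochromeP _ _ (jle j)); split; first by lia.
      move=> k /andP[k1 k2]; have [->//|ki] := eqVneq k (i'.-1).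
      by apply: H; lia.
    by move: M'; rewrite M1 /= -val_eqE /=; lia.
  - case/and3P => iw /eqP Hi Hp.
    (* The length of the block that starts at position i. *)
    pose d := find (predC1 b) (drop i w).
    have dle : (d <= size w - i)%N by rewrite -size_drop find_size.
    have lt : (i + d < (size w).+1)%N by lia.
    have Hin k : (i <= k < i + d)%N -> nth Up w k = b.
      move=> /andP[k1 k2].
      have := @before_find _ Up (predC1 b) (drop i w) (k - i)%N.
      rewrite nth_drop subnKC //= => /(_ _) H.
      by apply/eqP; apply: negbFE; apply: H; rewrite -/d; lia.
    have d0 : (0 < d)%N.
      rewrite /d (drop_nth Up) //= Hi eqxx //.
    exists (i, Ordinal lt) => //; rewrite inE /=; apply/andP; split.
      by apply/monochromeP => /=; [lia|split; [lia|exact: Hin]].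
    apply/forallP => i'; apply/forallP => j'; apply/implyP.
    case/and3P => /= i'i jj' /(monochromeP _ _ (jle j')) [ij H].
    apply/andP; split.
      rewrite -val_eqE /= eqn_leq i'i /= leqNgt; apply/negP => i'lt.
      case/orP: Hp => [/eqP|/eqP]; first by lia.
      by apply; apply: H; lia.
    rewrite -val_eqE /= eqn_leq jj' andbT leqNgt; apply/negP => jlt.
    have hf : has (predC1 b) (drop i w).
      by rewrite has_find size_drop -/d ltn_subRL (leq_trans jlt (jle j')).
    have := nth_find Up hf; rewrite /= nth_drop -/d => /eqP; apply.
    by apply: H; lia.
rewrite /colour_starts -sum1_card big_mkcond /= big_ord_recr /= inE ltnn /= addn0.
apply: eq_bigr => i _; rewrite inE /= ltn_ord startE /=.
by case: ifP.
Qed.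

Lemma colour_starts_cons b s a w :
  colour_starts b s (a :: w) = ((a == b) && (s != b) + colour_starts b a w)%N.
Proof. by rewrite /colour_starts /= big_ord_recl. Qed.

(** The contribution of a letter [a] that follows [s]: every down step counts for
[1] (half of the length), and a new block adds [1] for blue and [-1] for red.  The
total is never negative, so that weights can serve as exponents. *)
Definition step_weight (s a : letter) : nat :=
  match a with Up => 0 | Blue => 1 + (s != Blue) | Red => (s == Red) end.

Fixpoint word_weight (s : letter) (w : seq letter) : nat :=
  if w is a :: w' then (step_weight s a + word_weight a w')%N else 0.

Lemma word_weight_rcons s w a :
  word_weight s (rcons w a) = (word_weight s w + step_weight (last s w) a)%N.
Proof. by elim: w s => [|x w IH] s /=; rewrite ?addn0 // IH addnA. Qed.

Lemma word_weightE s w :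
  (word_weight s w)%:Z = (count (predC1 Up) w)%:Z
    + (colour_starts Blue s w)%:Z - (colour_starts Red s w)%:Z.
Proof.
elim: w s => [|a w IH] s; first by rewrite /colour_starts /= !big_ord0.
rewrite /= !colour_starts_cons PoszD IH.
by case: a; rewrite /= ?letter_eqE ?eqxx /=; case: (s == Blue); case: (s == Red) => /=; lia.
Qed.

Lemma height_count w :
  height w = (size w)%:Z - (count (predC1 Up) w)%:Z *+ 2.
Proof.
elim: w => [|a w IH]; first by rewrite /height big_nil.
by rewrite /height big_cons -/(height w) IH; case: a; rewrite /= ?letter_eqE ?eqxx /=; lia.
Qed.

Lemma weight_dyck2 w : height w = 0 -> weight w = (word_weight Up w)%:Z.
Proof.
rewrite height_count => h0.
rewrite word_weightE -!nblocks_starts ?letter_eqE // /weight.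
have -> : size w = (count (predC1 Up) w).*2 by lia.
by rewrite doubleK.
Qed.

(** * The transfer recurrence on paths *)

Definition letters := [:: Up; Blue; Red].

Lemma letter_sum (K : nmodType) (s : letter) (F : letter -> K) :
  \sum_(a <- letters | a == s) F a = F s.
Proof.
rewrite /letters !big_cons big_nil.
by case: s; rewrite ?letter_eqE eqxx ?addr0.
Qed.

Fixpoint words (n : nat) : seq (seq letter) :=
  if n is n'.+1 then [seq rcons w a | w <- words n', a <- letters]
  else [:: [::]].

Lemma wordsS n : words n.+1 = [seq rcons w a | w <- words n, a <- letters].
Proof. by []. Qed.

Lemma mem_words n w : (w \in words n) = (size w == n).
Proof.
elim: n w => [|n IH] w; first by rewrite inE size_eq0.
rewrite wordsS; apply/allpairsP/idP.
  by case=> -[v a] /= [+ _ ->]; rewrite IH size_rcons.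
case/lastP: w => // w a; rewrite size_rcons eqSS -IH => wn.
by exists (w, a); split=> //; case: a; rewrite !inE eqxx ?orbT.
Qed.

Lemma uniq_words n : uniq (words n).
Proof.
elim: n => // n IH; rewrite wordsS; apply: allpairs_uniq => //.
  by rewrite /letters /= !inE ?letter_eqE.
by move=> [w a] [v b] _ _ /= /rcons_inj [-> ->].
Qed.

Lemma num_dyck2E m k :
  num_dyck2 m k =
  count (fun w => dyck2 w && (weight w == k%:Z)) (words (2 * m)).
Proof.
set P := fun w : seq letter => dyck2 w && _.
have -> : num_dyck2 m k = count P (map val (enum {: (2 * m).-tuple letter})).
  rewrite /num_dyck2 cardE size_filter count_map enumT.
  by apply: eq_count => w; rewrite /= inE.
apply/permP; apply: uniq_perm; rewrite ?uniq_words //.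
  by rewrite map_inj_uniq ?enum_uniq //; exact: val_inj.
move=> w; rewrite mem_words; apply/mapP/eqP.
  by case=> t _ ->; rewrite size_tuple.
move=> /eqP sw; exists (Tuple sw) => //.
by rewrite mem_enum.
Qed.

Definition nonneg_path (w : seq letter) : bool :=
  [forall i : 'I_(size w).+1, 0 <= height (take i w)].

Lemma height_rcons w a : height (rcons w a) = height w + step a.
Proof. by rewrite /height big_rcons. Qed.

Lemma nonneg_path_rcons w a :
  nonneg_path (rcons w a) = nonneg_path w && (0 <= height (rcons w a)).
Proof.
have tk i : (i <= size w)%N -> take i (rcons w a) = take i w.
  by move=> iw; rewrite -cats1 takel_cat.
apply/forallP/andP => [H|[/forallP H H1] i].
  split; last first.
    by have := H ord_max; rewrite take_size.
  apply/forallP => i; have lt : (i < (size (rcons w a)).+1)%N.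
    by rewrite size_rcons ltnS ltnW.
  by have := H (Ordinal lt); rewrite /= tk // -ltnS.
have [iw|iw] := leqP i (size w).
  rewrite tk //; have lt : (i < (size w).+1)%N by [].
  exact: (H (Ordinal lt)).
have sz : (size (rcons w a) <= i)%N by apply: leq_trans iw; rewrite size_rcons.
by rewrite take_oversize.
Qed.

(** Removing the last letter [s] of a path of length [n] that ends at height [h]
leaves a path ending at height [h - 1] or [h + 1] whose last letter [a] decides
whether [s] opens a block.  The empty path is filed under [Up], since no block is
open at its end. *)
Fixpoint path_gf (K : comNzRingType) (t : K) (n h : nat) (s : letter) : K :=
  if n is n'.+1 then
    match s with
    | Up => if h is h'.+1 then \sum_(a <- letters) path_gf t n' h' a else 0
    | _ => \sum_(a <- letters) path_gf t n' h.+1 a * t ^+ step_weight a s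
    end
  else ((h == 0%N) && (s == Up))%:R.

Lemma path_gfE (K : comNzRingType) (t : K) n h s :
  path_gf t n h s =
  \sum_(w <- words n | [&& nonneg_path w, height w == h%:Z & last Up w == s])
    t ^+ word_weight Up w.
Proof.
elim: n h s => [|n IH] h s.
  rewrite /= big_cons big_nil /= /height big_nil /= addr0 expr0.
  have -> : nonneg_path [::] by apply/forallP => i; rewrite /height /= big_nil.
  by rewrite eqz_nat [0%N == h]eq_sym [Up == s]eq_sym; case: (_ && _).
pose F h w := nonneg_path w && (height w == h).
have lastE : \sum_(w <- words n.+1 | [&& nonneg_path w, height w == h%:Z
      & last Up w == s]) t ^+ word_weight Up w =
    \sum_(w <- words n | F (h%:Z - step s) w)
      t ^+ word_weight Up w * t ^+ step_weight (last Up w) s.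
  rewrite wordsS big_mkcond big_allpairs_dep [RHS]big_mkcond /=.
  apply: eq_bigr => w _.
  rewrite -(letter_sum s (fun s => if F (h%:Z - step s) w then
    _ ^+ _ * t ^+ step_weight (last Up w) s else 0)) [RHS]big_mkcond /=.
  apply: eq_bigr => a _.
  rewrite last_rcons nonneg_path_rcons height_rcons word_weight_rcons exprD /F.
  have [->|_] := eqVneq a s; rewrite ?andbF ?andbT //.
  rewrite [height w == _]eq_sym subr_eq [h%:Z == _]eq_sym -andbA.
  by case: (nonneg_path w) => //=; case: eqP => [->|_]; rewrite ?andbF // lez_nat.
have splitE (h' : nat) : \sum_(w <- words n | F h'%:Z w)
      t ^+ word_weight Up w * t ^+ step_weight (last Up w) s =
   \sum_(a <- letters) path_gf t n h' a * t ^+ step_weight a s.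
  under [RHS]eq_bigr do rewrite IH big_distrl big_mkcond /=.
  rewrite exchange_big /= big_mkcond; apply: eq_bigr => w _ /=.
  rewrite -(letter_sum (last Up w) (fun a => if F h' w then
    _ ^+ _ * t ^+ step_weight a s else 0)) big_mkcond /=.
  apply: eq_bigr => a _; rewrite andbA -/(F _ _) [a == _]eq_sym.
  by case: (last Up w == a); rewrite ?andbT ?andbF.
rewrite lastE; case: s {lastE} splitE => /= splitE.
- case: h => [|h].
    (* An up step cannot end on the axis: the path would come from height -1. *)
    rewrite big1_seq // => w /andP[/andP[+ /eqP hw] _].
    by move/forallP/(_ ord_max); rewrite /= take_size hw.
  have -> : h.+1%:Z - 1 = h%:Z by lia.
  by rewrite splitE; apply: eq_bigr => a _; rewrite mulr1.
- have -> : h%:Z - -1 = h.+1%:Z by lia.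
  by rewrite splitE.
- have -> : h%:Z - -1 = h.+1%:Z by lia.
  by rewrite splitE.
Qed.

(** * The generating polynomial of Dyck words *)

Lemma path_gf_short (K : comNzRingType) (t : K) n h s :
  (n < h)%N -> path_gf t n h s = 0.
Proof.
elim: n h s => [|n IH] [|h] s //= nh.
by case: s => /=; rewrite big1 // => a _; rewrite IH ?mul0r //; lia.
Qed.

Lemma path_gf_rmorph (K L : comNzRingType) (f : {rmorphism K -> L}) (t : K) n h s :
  path_gf (f t) n h s = f (path_gf t n h s).
Proof.
elim: n h s => [|n IH] h s /=; first by rewrite rmorph_nat.
case: s; first case: h => [|h]; rewrite ?rmorph0 // rmorph_sum;
  by apply: eq_bigr => a _; rewrite ?rmorphM ?rmorphXn IH.
Qed.

Definition dyck_gf (K : comNzRingType) (t : K) (m : nat) : K :=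
  \sum_(s <- letters) path_gf t (2 * m) 0 s.

Lemma dyck_gfE (K : comNzRingType) (t : K) m :
  dyck_gf t m = \sum_(w <- words (2 * m) | dyck2 w) t ^+ word_weight Up w.
Proof.
rewrite /dyck_gf.
under eq_bigr do rewrite path_gfE big_mkcond /=.
rewrite exchange_big /= [RHS]big_mkcond; apply: eq_bigr => w _ /=.
rewrite -(letter_sum (last Up w) (fun a => if dyck2 w then
    t ^+ word_weight Up w else 0)) [RHS]big_mkcond /=.
apply: eq_bigr => a _; rewrite andbA -/(dyck2 w) [a == _]eq_sym.
by case: (last Up w == a); rewrite ?andbT ?andbF.
Qed.

(** On a Dyck word the number of down steps is the half-length, so the exponent
[word_weight] is the weight itself. *)
Lemma coef_dyck_gf m k :
  (dyck_gf ('X : {poly int}) m)`_k = (num_dyck2 m k)%:Z.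
Proof.
rewrite dyck_gfE coef_sum num_dyck2E -sum1_count [in RHS]big_mkcondr /=.
rewrite (big_morph Posz PoszD (erefl (Posz 0))) /=; apply: eq_bigr => w.
case/andP => _ /eqP h0; rewrite coefXn weight_dyck2 // eqz_nat eq_sym.
by case: eqP.
Qed.

Definition swap (s : letter) : letter :=
  match s with Up => Up | Blue => Red | Red => Blue end.

Lemma sum_swap (K : nmodType) (F : letter -> K) :
  \sum_(a <- letters) F (swap a) = \sum_(a <- letters) F a.
Proof. by rewrite /letters !big_cons !big_nil /=; congr (_ + _); exact: addrCA. Qed.

(** Exchanging the colours turns a new blue step (weight [2]) into a new red one
(weight [0]) and keeps the weight [1] of the other down steps.  A path from
height [0] to [h] of length [2m + h] has [m] down steps, so its weight [k]
becomes [2m - k]. *)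
Lemma path_gf_swap (K : fieldType) (t : K) m h s : t != 0 ->
  t ^+ (2 * m) * path_gf t^-1 (2 * m + h) h s = path_gf t (2 * m + h) h (swap s).
Proof.
move=> t0; move: {-1}(2 * m + h)%N (erefl (2 * m + h)%N) => n.
elim: n m h s => [|n IH] m h s nE.
  have -> : m = 0%N by lia.
  by rewrite expr0 mul1r; case: s; rewrite /= ?letter_eqE.
case: m nE => [|m] nE.
  rewrite muln0 expr0 mul1r; case: s => /=.
  - case: h nE => [|h] nE //; rewrite -[RHS]sum_swap; apply: eq_bigr => a _.
    by rewrite -(IH 0%N) ?expr0 ?mul1r //; lia.
  - by rewrite !big1 // => a _; rewrite path_gf_short ?mul0r //; lia.
  - by rewrite !big1 // => a _; rewrite path_gf_short ?mul0r //; lia.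
have down a : t ^+ (2 * m.+1) * path_gf t^-1 n h.+1 a =
    path_gf t n h.+1 (swap a) * t ^+ 2.
  by rewrite -(IH m); [rewrite mulnS addnC exprD mulrAC|lia].
case: s => /=.
- case: h nE {down} => [|h] nE; first by rewrite mulr0.
  by rewrite -[RHS]sum_swap mulr_sumr; apply: eq_bigr => a _; rewrite IH //; lia.
- rewrite -[RHS]sum_swap mulr_sumr; apply: eq_bigr => a _; rewrite mulrA down -mulrA.
  by congr (_ * _); case: a => /=; rewrite ?letter_eqE ?eqxx /= exprVn; field; rewrite ?oner_neq0.
- rewrite -[RHS]sum_swap mulr_sumr; apply: eq_bigr => a _; rewrite mulrA down -mulrA.
  by congr (_ * _); case: a => /=; rewrite ?letter_eqE ?eqxx /= exprVn; field; rewrite ?oner_neq0.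
Qed.

(** Each of the [m] down steps adds at most [2].  A final red step adds at most
[1], so a path that ends in [Red] never reaches the maximal weight [2m]; the
induction for the leading coefficient rests on this gain. *)
Lemma size_path_gf m h s :
  (size (path_gf ('X : {poly int}) (2 * m + h) h s) <= (2 * m).+1 - (s == Red))%N.
Proof.
move: {-1}(2 * m + h)%N (erefl (2 * m + h)%N) => n.
elim: n m h s => [|n IH] m h s nE.
  have -> : m = 0%N by lia. have -> : h = 0%N by lia.
  by case: s; rewrite /= ?letter_eqE ?eqxx ?size_poly1 ?size_poly0.
have sum_le (F : letter -> {poly int}) k :
  (forall a, size (F a) <= k)%N -> (size (\sum_(a <- letters) F a)%R <= k)%N.
  by move=> Fk; apply: (leq_trans (size_sum _ _ _)); apply/bigmax_leqP_seq.
case: m nE => [|m] nE.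
  case: s => /=; last 2 first.
  - by rewrite big1 ?size_poly0 // => a _; rewrite path_gf_short ?mul0r //; lia.
  - by rewrite big1 ?size_poly0 // => a _; rewrite path_gf_short ?mul0r //; lia.
  case: h nE => [|h] nE; first by rewrite size_poly0.
  by apply: sum_le => a; apply: (leq_trans (IH 0%N _ _ _)); rewrite ?letter_eqE; lia.
have down a k : (size (path_gf ('X : {poly int}) n h.+1 a * 'X^k)%R <= (2 * m).+1 - (a == Red) + k)%N.
  have [->|p0] := eqVneq (path_gf ('X : {poly int}) n h.+1 a) 0.
    by rewrite mul0r size_poly0.
  by rewrite size_mulXn // addnC leq_add2r; apply: IH; lia.
case: s => /=; first (case: h nE {down} => [|h] nE; first by rewrite size_poly0);
  apply: sum_le => a.
- by apply: (leq_trans (IH m.+1 _ _ _)); rewrite ?letter_eqE; lia.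
- apply: (leq_trans (down _ _)); rewrite letter_eqE.
  by case: (a == Blue) (a == Red) => -[] /=; lia.
- apply: (leq_trans (down _ _)); rewrite eqxx.
  by case: (a == Red) => /=; lia.
Qed.

(** A word of weight [2m] has only new blue down steps, so each of them follows an
[Up]: at the coefficient [2m.+2], removing the final [Up Blue] is the only
possibility. *)
Lemma lead_dyck_gf m : (dyck_gf ('X : {poly int}) m)`_(2 * m) = 1.
Proof.
elim: m => [|m IH].
  by rewrite /dyck_gf /letters !big_cons big_nil /= ?letter_eqE eqxx !coefD !coef0 coef1.
rewrite /dyck_gf /letters !big_cons big_nil addr0 !coefD.
have -> : path_gf ('X : {poly int}) (2 * m.+1) 0 Up = 0 by rewrite mulnS.
have -> : (path_gf ('X : {poly int}) (2 * m.+1) 0 Red)`_(2 * m.+1) = 0.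
  have := size_path_gf m.+1 0 Red; rewrite addn0 eqxx => sz.
  by rewrite nth_default //; lia.
rewrite coef0 add0r addr0 mulnS [(2 + _)%N]/=.
have -> : path_gf ('X : {poly int}) (2 * m).+2 0 Blue =
  \sum_(a <- letters) path_gf 'X (2 * m + 1) 1 a * 'X ^+ step_weight a Blue.
  by rewrite addn1.
rewrite /letters !big_cons big_nil addr0 !coefD /= ?letter_eqE ?eqxx /=.
have szB := size_path_gf m 1 Blue; have szR := size_path_gf m 1 Red.
rewrite letter_eqE in szB; rewrite eqxx in szR.
have -> : (2 + 2 * m = (2 * m).+2)%N by lia.
rewrite !coefMXn /= !subn2 !subn1 /=.
rewrite [X in _ + (X + _)]nth_default; last by apply: leq_trans szB _; rewrite subn0.
rewrite [X in _ + (_ + X)]nth_default; last by apply: leq_trans szR _; rewrite subn1.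
by rewrite !addr0 -IH addn1.
Qed.

Lemma dyck_gf_rmorph (K L : comNzRingType) (f : {rmorphism K -> L}) (t : K) m :
  dyck_gf (f t) m = f (dyck_gf t m).
Proof. by rewrite /dyck_gf rmorph_sum; apply: eq_bigr => s _; exact: path_gf_rmorph. Qed.

Lemma dyck_gf_horner (K : comNzRingType) (x : K) m :
  dyck_gf x m = (map_poly intr (dyck_gf ('X : {poly int}) m)).[x].
Proof.
rewrite -(dyck_gf_rmorph (map_poly intr)) /= map_polyX -/(horner_eval x _).
by rewrite -(dyck_gf_rmorph (horner_eval x)); congr (dyck_gf _ m); exact/esym/hornerX.
Qed.

Lemma dyck_gf_nat (K : comNzRingType) (q m : nat) :
  dyck_gf (q%:R : K) m = ((dyck_gf ('X : {poly int}) m).[q%:R])%:~R.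
Proof.
transitivity ((dyck_gf (q%:R : int) m)%:~R : K).
  by rewrite -(dyck_gf_rmorph (intr : int -> K)) rmorph_nat.
rewrite -/(horner_eval _ _) -(dyck_gf_rmorph (horner_eval (q%:R : int))).
by congr ((dyck_gf _ m)%:~R); exact/esym/hornerX.
Qed.

Lemma size_dyck_gf m : size (dyck_gf ('X : {poly int}) m) = (2 * m).+1.
Proof.
apply/eqP; rewrite eqn_leq; apply/andP; split.
  rewrite (leq_trans (size_sum _ _ _)) //; apply/bigmax_leqP_seq => s _ _.
  by have := size_path_gf m 0 s; rewrite addn0 => h; rewrite (leq_trans h) // leq_subr.
rewrite ltnNge; apply/negP => h.
by have := lead_dyck_gf m; rewrite nth_default.
Qed.

Lemma dyck_gf_inv (K : fieldType) (x : K) m : x != 0 ->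
  x ^+ (2 * m) * dyck_gf x^-1 m = dyck_gf x m.
Proof.
move=> x0; rewrite /dyck_gf mulr_sumr -[RHS]sum_swap; apply: eq_bigr => s _.
by have := path_gf_swap m 0 s x0; rewrite addn0.
Qed.

Lemma palindromic_dyck_gf m : palindromic (dyck_gf 'X m).
Proof. by move=> x x0; rewrite size_dyck_gf /= -!dyck_gf_horner dyck_gf_inv. Qed.

Lemma monic_dyck_gf m : dyck_gf ('X : {poly int}) m \is monic.
Proof. by rewrite monicE lead_coefE size_dyck_gf lead_dyck_gf. Qed.

Lemma eq_coefs_modXn (K : comNzRingType) (N : nat) (p q : {poly K}) :
  (forall i, (i < N)%N -> p`_i = q`_i) -> exists r, p = q + 'X^N * r.
Proof.
move=> pq; exists (drop_poly N (p - q)).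
rewrite -[LHS](subrK q) addrC -{1}(poly_take_drop N (p - q)).
have -> : take_poly N (p - q) = 0.
  apply/polyP => i; rewrite coef_take_poly coef0 coefB.
  by case: ifP => // /pq ->; rewrite subrr.
by rewrite add0r [_ * 'X^N]mulrC.
Qed.

(** * The quadratic equation for Dyck words *)

Section QuadraticEquation.
Variables (K : comNzRingType) (t : K) (N : nat).

(* A path of length 2 m + h from height 0 to height h has m down steps; the
   variable 'X marks these.  All series are truncated at degree N. *)
Let c m h s := path_gf t (2 * m + h) h s.
Let E s : {poly K} := \poly_(m < N) c m 0 s.
Let D : {poly K} := \poly_(m < N) dyck_gf t m.

Let c_Up m h : c m h.+1 Up = \sum_(a <- letters) c m h a.
Proof. by rewrite /c addnS. Qed.

Let c_down0 h s : s != Up -> c 0 h s = 0.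
Proof.
rewrite /c muln0 add0n; case: h => [|h]; case: s => //=; rewrite ?eqxx //=;
  by move=> _; rewrite ?letter_eqE ?big1 // => a _; rewrite path_gf_short ?mul0r.
Qed.

Let c_downS m h s : s != Up ->
  c m.+1 h s = \sum_(a <- letters) c m h.+1 a * t ^+ step_weight a s.
Proof.
rewrite /c; have -> : (2 * m.+1 + h = (2 * m + h.+1).+1)%N by lia.
by case: s; rewrite ?eqxx.
Qed.

Let DE : D = \sum_(a <- letters) E a.
Proof.
apply/polyP => i; rewrite coef_poly coef_sum.
under eq_bigr do rewrite coef_poly.
by case: ifP => iN; [rewrite /dyck_gf /c addn0 | rewrite big1].
Qed.

(* The words that end with the down step s: a Dyck word, an up step back from the
   axis, a Dyck word (whose last letter a decides the weight of s), then s. *)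
Let last_return s := 'X * (D * \sum_(a <- letters) E a * (t ^+ step_weight a s)%:P).

(* The case h = 1 of the product formula in degree m - 1 is the last-return
   equation in degree m, so both are proved by the same induction. *)
Let coef_E_down m : (forall m', (m' < m)%N -> (m' < N)%N ->
    forall h s, c m' h s = (D ^+ h * E s)`_m') ->
  (m < N)%N -> forall s, s != Up -> (E s)`_m = (last_return s)`_m.
Proof.
move=> H mN s sU; rewrite coefXM coef_poly mN; case: m mN H => [|m] mN H /=.
  exact: c_down0.
rewrite c_downS // mulr_sumr coef_sum; apply: eq_bigr => a _.
by rewrite mulrA coefMC H ?expr1 // ltnW.
Qed.

(* The last-passage decomposition: a path to height h is a sequence of h Dyck
   words, each followed by an up step, and a final Dyck word, which carries the
   last letter. *)
Let coef_DE m : (m < N)%N -> forall h s, c m h s = (D ^+ h * E s)`_m.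
Proof.
elim/ltn_ind: m => m IH mN.
have Hd h s : s != Up -> c m h s = (D ^+ h * E s)`_m.
  move=> sU.
  have -> : (D ^+ h * E s)`_m = (D ^+ h * last_return s)`_m.
    rewrite !coefM; apply: eq_bigr => i _; congr (_ * _).
    apply: coef_E_down => // [m' m'm m'N|]; last by lia.
    by apply: IH => //; lia.
  rewrite /last_return mulrCA coefXM; case: m mN IH => [|m] mN IH /=.
    exact: c_down0.
  rewrite mulrA -exprSr mulr_sumr coef_sum c_downS //; apply: eq_bigr => a _.
  by rewrite mulrA coefMC IH // ltnW.
elim=> [|h IHh] s.
  by rewrite expr0 mul1r coef_poly mN.
have [->|sU] := eqVneq s Up; last exact: Hd.
rewrite c_Up; under eq_bigr do rewrite IHh.
rewrite -coef_sum -mulr_sumr -DE -exprSr.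
have -> : E Up = 1; last by rewrite mulr1.
apply/polyP => i; rewrite coef_poly coef1 /c; case: ifP => iN; last by case: i iN => //; lia.
by case: i {iN} => [|i] //=; rewrite eqxx.
Qed.

(** The three series [E Up = 1], [E Blue], [E Red] satisfy, up to degree [N], a
linear system with
coefficients in [u = 'X * D], of determinant [1 - 2 t u]; solving it and summing
gives [D] back. *)
Lemma dyck_gf_quadratic : exists r : {poly K},
  D - 2 * t%:P * 'X * D ^+ 2 =
  1 + (t%:P - 1) ^+ 2 * 'X * D - t%:P * (t%:P - 1) ^+ 2 * 'X^2 * D ^+ 2 + 'X^N * r.
Proof.
have EU : exists r, E Up = 1 + 'X^N * r.
  apply: eq_coefs_modXn => i iN; rewrite coef_poly iN coef1 /c addn0.
  by case: i {iN} => [|i] //=; rewrite eqxx.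
have Edown s : s != Up -> exists r, E s = last_return s + 'X^N * r.
  move=> sU; apply: eq_coefs_modXn => i iN; apply: coef_E_down => // m' _ m'N.
  exact: coef_DE.
have [r0 U0] := EU.
have [r1 B1] := Edown Blue (negbT letter_eqE.1.1.1.2).
have [r2 R2] := Edown Red (negbT letter_eqE.1.2).
move: B1 R2 (DE); rewrite /last_return /letters !big_cons !big_nil !addr0 /=.
rewrite ?letter_eqE ?eqxx /= !expr0 expr1 polyC1 polyC_exp !mulr1.
set T := t%:P; set Z := 'X^N; set y := 'X.
move: (E Up) (E Blue) (E Red) (D) U0 => U B R F U0 B1 R2 FE.
pose u := y * F.
(* Cramer's rule: the error terms are combined by the cofactors of the system. *)
exists (r1 * (1 - T * u + u) + r2 * (1 - T * u + T ^+ 2 * u) +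
  r0 * (1 - 2 * T * u + u * (T ^+ 2 - T ^+ 3 * u + 2 * T ^+ 2 * u + 1 - T * u))).
have e1 : Z * r1 = B - u * (T ^+ 2 * U + T * B + T ^+ 2 * R).
  by rewrite {1}B1 /u; ring.
have e2 : Z * r2 = R - u * (U + B + T * R) by rewrite {1}R2 /u; ring.
have e0 : Z * r0 = U - 1 by rewrite U0 addrAC subrr add0r.
rewrite [Z * _](_ : _ = Z * r1 * (1 - T * u + u) + Z * r2 * (1 - T * u + T ^+ 2 * u) +
  Z * r0 * (1 - 2 * T * u + u * (T ^+ 2 - T ^+ 3 * u + 2 * T ^+ 2 * u + 1 - T * u)));
  last by ring.
by rewrite e1 e2 e0 /u FE; ring.
Qed.

End QuadraticEquation.

(** * From the quadratic equation to the three-term recurrence *)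

Section ResolventSeries.
Variables (F : numFieldType) (q : F) (N : nat) (D r : {poly F}).
Let p := q - 1.
Let a := q + 1.
Let c := p ^+ 2 * a.

Hypothesis D_quadratic :
  D - 2 * q%:P * 'X * D ^+ 2 =
  1 + (q%:P - 1) ^+ 2 * 'X * D - q%:P * (q%:P - 1) ^+ 2 * 'X^2 * D ^+ 2 + 'X^N * r.

(* Z will be the series of the zeta values, G that of the normalised moments
   I_(n+1), both after the substitution x = c 'X in their natural variable x;
   G = Z (2 - x / a) - 1 is the partial fraction identity, and S is a square root
   of Q up to degree N. *)
Let Z : {poly F} := 1 + (q * p)%:P * 'X * D.
Let G : {poly F} := Z * (2 - (p ^+ 2)%:P * 'X) - 1.
Let S : {poly F} := a%:P - c%:P * 'X - 2 * G.
Let Q : {poly F} := (p ^+ 2)%:P - (2 * a * c)%:P * 'X + (c ^+ 2)%:P * 'X^2.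

Let S_sqr : exists s, S ^+ 2 = Q + 'X^(N.+1) * s.
Proof.
exists (4 * (p ^+ 2)%:P * q%:P * (2 - (p ^+ 2)%:P * 'X) * (- r)).
have -> : 'X^(N.+1) * (4 * (p ^+ 2)%:P * q%:P * (2 - (p ^+ 2)%:P * 'X) * (- r)) =
  - (4 * (p ^+ 2)%:P * q%:P * (2 - (p ^+ 2)%:P * 'X) * 'X * ('X^N * r)).
  by rewrite exprS; ring.
have -> : 'X^N * r = D - 2 * q%:P * 'X * D ^+ 2 - (1 + (q%:P - 1) ^+ 2 * 'X * D
   - q%:P * (q%:P - 1) ^+ 2 * 'X^2 * D ^+ 2).
  by rewrite D_quadratic addrAC subrr add0r.
rewrite /S /Q /G /Z /c /p /a.
rewrite !(polyCM, polyCD, polyCN, rmorphXn, polyCB) /=.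
rewrite polyC1; ring.
Qed.

(* Multiply the derivative 2 S S' = Q' of S^2 = Q by S. *)
Let S_ode : exists s, 2 * Q * S^`() - Q^`() * S = 'X^N * s.
Proof.
have [s S2] := S_sqr.
have dS : 2 * S * S^`() = Q^`() + 'X^N * (N.+1%:R * s + 'X * s^`()).
  transitivity ((S ^+ 2)^`()); first by rewrite expr2 derivM; ring.
  rewrite S2 derivD derivM derivXn -mulr_natl exprS /=.
  by move: ('X^N) (N.+1%:R) => Y n; ring.
exists (- (2 * 'X * s * S^`()) + S * (N.+1%:R * s + 'X * s^`())).
have -> : Q = S ^+ 2 - 'X^(N.+1) * s by rewrite S2 addrK.
have -> : (S ^+ 2 - 'X^(N.+1) * s)^`() = Q^`() by rewrite S2 addrK.
have -> : Q^`() = 2 * S * S^`() - 'X^N * (N.+1%:R * s + 'X * s^`()).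
  by rewrite dS addrK.
by rewrite ['X^(N.+1)]exprS; move: ('X^N) (N.+1%:R) => Y n; ring.
Qed.

Let QE i : (2 * Q * S^`())`_i = 2 * (p ^+ 2 * S^`()`_i -
  2 * a * c * ('X * S^`())`_i + c ^+ 2 * ('X^2 * S^`())`_i).
Proof.
rewrite /Q -mulrA mulr_natl coefMn mulrDl mulrBl !coefD coefN.
by rewrite -![_%:P * _ * _]mulrA !coefCM [RHS]mulr_natl.
Qed.

Let Q'E i : (Q^`() * S)`_i = - (2 * a * c) * S`_i + 2 * c ^+ 2 * ('X * S)`_i.
Proof.
rewrite /Q !mul_polyC derivD derivB derivC !derivZ derivX derivXn sub0r /= expr1.
rewrite mulrDl coefD mulNr coefN -!scalerAl !coefZ mul1r ['X *+ 2 * _]mulrnAl coefMn.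
by ring.
Qed.

Let ode_coef i : (i < N)%N -> (2 * Q * S^`())`_i = (Q^`() * S)`_i.
Proof.
move=> iN; have [s /(congr1 (fun P : {poly F} => P`_i))] := S_ode.
by rewrite coefB coefXnM iN => /eqP; rewrite subr_eq0 => /eqP.
Qed.

Let S0 : S`_0 = a - 2 * G`_0.
Proof. by rewrite /S 2!coefB coefC coefCM coefX /= mulr0 subr0 mulr_natl coefMn mulr_natl. Qed.

Let S1 : S`_1 = - c - 2 * G`_1.
Proof. by rewrite /S 2!coefB coefC coefCM coefX /= mulr1 sub0r mulr_natl coefMn mulr_natl. Qed.

Let S2 i : S`_i.+2 = - 2 * G`_i.+2.
Proof.
by rewrite /S 2!coefB coefC coefCM coefX /= mulr0 subr0 sub0r mulr_natl coefMn mulNr mulr_natl.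
Qed.

Let Z0 : Z`_0 = 1.
Proof. by rewrite /Z coefD coef1 -mulrA coefCM coefXM mulr0 addr0. Qed.

Let ZS i : Z`_i.+1 = q * p * D`_i.
Proof. by rewrite /Z coefD coef1 -mulrA coefCM coefXM add0r. Qed.

Let G0 : G`_0 = 1.
Proof.
rewrite /G mulrBr coefB coef1 mulrCA coefB coefCM [Z * 'X]mulrC coefXM mulr0 subr0.
by rewrite mulr_natr coefMn Z0 /=; ring.
Qed.

Let GS i : G`_i.+1 = 2 * Z`_i.+1 - p ^+ 2 * Z`_i.
Proof.
rewrite /G mulrBr coefB coef1 mulrCA coefB coefCM [Z * 'X]mulrC coefXM subr0.
by rewrite mulr_natr coefMn [2 * _ in RHS]mulr_natl.
Qed.

Hypotheses (p0 : p != 0) (a0 : a != 0).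

Let G1 : (0 < N)%N -> G`_1 = p * a.
Proof.
move=> N0; have := ode_coef N0; rewrite QE Q'E !coefXM coefXnM /= !mulr0 !addr0 subr0.
rewrite coef_deriv S1 S0 G0 mulr1n => H.
have {}H : (2 * p ^+ 2 * 2) * G`_1 = (2 * p ^+ 2 * 2) * (p * a).
  rewrite (_ : 2 * p ^+ 2 * 2 * G`_1 =
    - (2 * (p ^+ 2 * (- c - 2 * G`_1))) - 2 * p ^+ 2 * c); last by ring.
  by rewrite H /c /a /p; ring.
by apply: (mulfI _ H); rewrite !mulf_neq0 ?expf_neq0 ?pnatr_eq0.
Qed.

(* The coefficients of S are those of - 2 G except in degrees 0 and 1; this
   perturbation cancels out of the recurrence, in degree 3 because the factor
   (1 - n) vanishes. *)
Let Grec n : (n.+1 < N)%N ->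
  n.+2%:R * p ^+ 2 * G`_n.+2 =
  (2 * n%:R + 1) * a * c * G`_n.+1 + (1 - n%:R) * c ^+ 2 * G`_n.
Proof.
move=> nN; have := ode_coef nN.
rewrite QE Q'E !coefXM coefXnM /= !coef_deriv.
have m4 : (-4 : F) != 0 by rewrite oppr_eq0 pnatr_eq0.
have lin (x y A B : F) : -4 * (x - y) = A - B -> A = B -> x = y.
  move=> e AB; apply/eqP; rewrite -subr_eq0; apply/eqP; apply: (mulfI m4).
  by rewrite e AB mulr0 subrr.
case: n nN => [|[|n]] nN /=; rewrite ?mulr0 ?addr0 !S2 ?S1 ?S0 ?G0.
- by apply: lin; ring.
- by rewrite subnn; apply: lin; ring.
- rewrite (_ : (n.+3 - 2)%N = n.+1); last by lia.
  by apply: lin; ring.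
Qed.

(* For the moments of the semicircle density, divided by 2 pi: those of
   (a - x)^(-n) for i_, those of (a - x)^(-n) (a + x)^(-1) for j_. *)
Variables (i_ j_ : nat -> F).
Hypotheses (i0 : i_ 0 = q) (i1 : i_ 1 = 1) (j0 : j_ 0 = 1).
Hypothesis i_rec : forall n,
  n.+1%:R * p ^+ 2 * i_ n.+2 = (2 * n%:R - 1) * a * i_ n.+1 + (2 - n%:R) * i_ n.
Hypothesis j_rec : forall n, 2 * a * j_ n.+1 = i_ n.+1 + j_ n.

Let G_moments n : (n <= N)%N -> G`_n = c ^+ n * i_ n.+1.
Proof.
elim/ltn_ind: n => -[|[|n]] IH nN.
- by rewrite G0 i1 mulr1.
- rewrite G1 //; have := i_rec 0; rewrite i1 i0 !mul1r mulr1 => H.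
  apply: (mulfI p0); rewrite expr1 /c.
  rewrite (_ : p * (p ^+ 2 * a * i_ 2) = p * a * (p ^+ 2 * i_ 2)); last by ring.
  by rewrite H /a /p; ring.
- have n0 : n.+2%:R * p ^+ 2 != 0 by rewrite mulf_neq0 ?expf_neq0 ?pnatr_eq0.
  apply: (mulfI n0); rewrite Grec // !IH //; try lia.
  rewrite (mulrCA _ (c ^+ n.+2)) i_rec !exprS -natr1; ring.
Qed.

Let Z_moments n : (n <= N)%N -> Z`_n = c ^+ n * (a * j_ n.+1).
Proof.
have two0 : (2 : F) != 0 by rewrite pnatr_eq0.
elim: n => [|n IH] nN; apply: (mulfI two0).
  by rewrite Z0 expr0 mul1r [RHS]mulrA j_rec i1 j0; ring.
rewrite -[LHS](subrK (p ^+ 2 * Z`_n)) -GS G_moments // IH 1?ltnW //.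
rewrite [RHS]mulrCA [2 * (a * _)]mulrA j_rec exprS /c; ring.
Qed.

(** [G] and the rescaled moments start in the same way and obey the same
recurrence, hence agree; by partial fractions so do [Z] and the rescaled
[a * j_]. *)
Lemma moments_dyck n : (n < N)%N ->
  a * j_ n.+2 = q / (p ^+ (2 * n).+1 * a ^+ n.+1) * D`_n.
Proof.
move=> nN; have := Z_moments nN; rewrite ZS => H.
have c0 : c ^+ n.+1 != 0 by rewrite expf_neq0 // mulf_neq0 // expf_neq0.
apply: (mulfI c0); rewrite -H /c.
rewrite exprMn -exprM mulnS !exprS mulnC; field.
by rewrite a0 p0 !expf_neq0.
Qed.

End ResolventSeries.

(** * Integration on a segment *)

Import numFieldNormedType.Exports.

Section IntegralsOnSegments.
Local Open Scope classical_set_scope.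
Variable R : realType.

(** At the end points the continuity of [asin] comes from its being the inverse of
the continuous injection [sin] on a segment. *)
Lemma asin_continuous_within :
  {within `[-1, 1 : R], continuous (@asin R)}.
Proof.
have h : - (pi / 2) <= pi / 2 :> R by have := pi_gt0 R; lra.
have := @segment_can_le_continuous R (- (pi / 2)) (pi / 2) sin asin h.
rewrite sinN sin_pihalf; apply; last exact: sinK.
by apply: continuous_subspaceT => x; exact: continuous_sin.
Qed.

Variables (l u : R).
Hypothesis lu : l < u.
Let mu := @lebesgue_measure R.

Lemma Rintegral_FTC (f F : R -> R) :
  {within `[l, u], continuous f} -> {within `[l, u], continuous F} ->
  (forall x, l < x < u -> is_derive x 1 F (f x)) ->
  \int[mu]_(x in `[l, u]) f x = F u - F l.
Proof.
move=> cf cF dF; rewrite /Rintegral (@continuous_FTC2 _ f F) //=.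
- have [_ Fl Fu] := (continuous_within_itvP _ lu).1 cF.
  by split=> // x; rewrite in_itv /= => /dF[].
- by move=> x; rewrite in_itv /= => /dF dFx; rewrite derive1E derive_val.
Qed.

Lemma integrable_continuous (f : R -> R) :
  {within `[l, u], continuous f} -> mu.-integrable `[l, u] (EFin \o f).
Proof. by apply: continuous_compact_integrable; exact: segment_compact. Qed.

Lemma continuous_asin_comp (f : R -> R) :
  {within `[l, u], continuous f} ->
  (forall x, l <= x <= u -> -1 <= f x <= 1) ->
  {within `[l, u], continuous (fun x => asin (f x))}.
Proof.
move=> /subspace_continuousP cf f1; apply/subspace_continuousP => x xlu.
have fx1 : `[-1, 1 : R]%classic (f x) by rewrite /= in_itv /= f1.
have /subspace_continuousP /(_ _ fx1) := asin_continuous_within.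
apply: cvg_comp => U /= Ux.
have := cf x xlu _ Ux; rewrite /nbhs /= /within /=.
apply: filterS => z Hz zlu; apply: (Hz zlu).
by rewrite /= in_itv /= f1.
Qed.
End IntegralsOnSegments.

Lemma asin1 (R : realType) : asin (1 : R) = pi / 2.
Proof.
rewrite -[X in asin X](sin_pihalf R) sinK // in_itv /= lexx andbT.
by have := pi_gt0 R; lra.
Qed.

Lemma asinN1 (R : realType) : asin (-1 : R) = - (pi / 2).
Proof.
rewrite -[X in asin (- X)](sin_pihalf R) -sinN sinK // in_itv /= lexx /=.
by have := pi_gt0 R; lra.
Qed.

(** Naming the square root [k] of [1 - f x ^+ 2] keeps square roots out of the
derivatives of the arcsines below. *)
Lemma is_derive_asin_comp (R : realType) (f : R -> R) (x df k : R) :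
  is_derive x 1 f df -> 0 < k -> 1 - f x ^+ 2 = k ^+ 2 ->
  is_derive x 1 (fun y => asin (f y)) (df / k).
Proof.
move=> dfx k0 fk; have fx : -1 < f x < 1.
  by apply/andP; have k2 : 0 < k ^+ 2 := exprn_gt0 2 k0; split; nra.
have d := is_derive1_comp (is_derive1_asin fx) dfx.
by apply: (is_derive_eq d); rewrite fk sqrtr_sqr gtr0_norm // mulrC.
Qed.

(** * Moments of the semicircle density *)

Section SemicircleIntegrals.
Local Open Scope classical_set_scope.
Variables (R : realType) (q : R).
Hypothesis q1 : 1 < q.
Let mu := @lebesgue_measure R.
Let r := 2 * Num.sqrt q.
Let a := q + 1.
Let p := q - 1.

Let w (x : R) := 4 * q - x ^+ 2.
Let s (x : R) := Num.sqrt (w x).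
Let v (x : R) := (a - x)^-1.
Let v' (x : R) := (a + x)^-1.

Definition resolvent_integral (n : nat) : R :=
  \int[mu]_(x in `[- r, r]) (s x * v x ^+ n).
Definition mixed_integral (n : nat) : R :=
  \int[mu]_(x in `[- r, r]) (s x * v x ^+ n * v' x).

Let r_gt0 : 0 < r.
Proof. by rewrite mulr_gt0 // sqrtr_gt0 (lt_trans _ q1). Qed.

Let rNr : - r < r.
Proof. by have := r_gt0; lra. Qed.

Let rr : r ^+ 2 = 4 * q.
Proof. by rewrite exprMn sqr_sqrtr ?(ltW (lt_trans _ q1)) //; ring. Qed.

Let r_lt_a : r < a.
Proof.
have := rr; have := r_gt0; have := q1; rewrite /a => h1 h2 h3.
rewrite -(ltr_pXn2r (n := 2)) ?nnegrE //; nra.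
Qed.

Let p_gt0 : 0 < p. Proof. by rewrite subr_gt0. Qed.

Lemma spectrum_lt x : - r <= x <= r -> 0 < a - x.
Proof. by move=> /andP[_ h]; rewrite subr_gt0 (le_lt_trans h). Qed.

Lemma spectrum_gt x : - r <= x <= r -> 0 < a + x.
Proof. by move=> /andP[h _]; have := r_lt_a; lra. Qed.

Let w_gt0 x : - r < x < r -> 0 < w x.
Proof. by move=> /andP[h1 h2]; rewrite /w -rr; nra. Qed.

Let w_continuous : continuous w.
Proof.
move=> x; apply: cvgB; first exact: cvg_cst.
by rewrite expr2; apply: cvgM; exact: cvg_id.
Qed.

Let s_continuous : continuous s.
Proof.
move=> x; apply: (@continuous_comp _ _ _ w Num.sqrt); first exact: w_continuous.
exact: sqrt_continuous.
Qed.

Let v_continuous x : - r <= x <= r -> {for x, continuous v}.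
Proof.
move=> /spectrum_lt h; apply: cvgV; first by rewrite gt_eqF.
by apply: cvgB; [exact: cvg_cst|exact: cvg_id].
Qed.

Let v'_continuous x : - r <= x <= r -> {for x, continuous v'}.
Proof.
move=> /spectrum_gt h; apply: cvgV; first by rewrite gt_eqF.
by apply: cvgD; [exact: cvg_cst|exact: cvg_id].
Qed.

Let vX_continuous n x : - r <= x <= r -> {for x, continuous (fun y => v y ^+ n)}.
Proof.
move=> xr; apply: (@continuous_comp _ _ _ v (fun y => y ^+ n)).
  exact: v_continuous.
exact: exprn_continuous.
Qed.

Let within (f : R -> R) : (forall x, - r <= x <= r -> {for x, continuous f}) ->
  {within `[- r, r], continuous f}.
Proof.
move=> cf; apply: continuous_in_subspaceT => x /set_mem /=.
by rewrite in_itv /=; exact: cf.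
Qed.

Let cst_within (k : R) : {within `[- r, r], continuous (cst k : R -> R)}.
Proof. by apply: (@within (cst k)) => x _; exact: cvg_cst. Qed.

Let s_within : {within `[- r, r], continuous s}.
Proof. by apply: within => x _; exact: s_continuous. Qed.

Let sv_continuous n : {within `[- r, r], continuous (fun x => s x * v x ^+ n)}.
Proof. by apply: within => x xr; apply: cvgM; [exact: s_continuous|exact: vX_continuous]. Qed.

Let svv'_continuous n :
  {within `[- r, r], continuous (fun x => s x * v x ^+ n * v' x)}.
Proof.
apply: within => x xr; apply: cvgM; last exact: v'_continuous.
by apply: cvgM; [exact: s_continuous|exact: vX_continuous].
Qed.

(** Partial fractions: [2a / ((a - x)(a + x)) = 1 / (a - x) + 1 / (a + x)]. *)
Lemma mixed_integralS n :
  2 * a * mixed_integral n.+1 = resolvent_integral n.+1 + mixed_integral n.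
Proof.
have int f : {within `[- r, r], continuous f} ->
  mu.-integrable `[- r, r] (EFin \o f) := @integrable_continuous _ _ _ _.
rewrite -RintegralZl //; last by apply: int; exact: svv'_continuous.
rewrite -RintegralD //; last 2 first.
- by apply: int; exact: sv_continuous.
- by apply: int; exact: svv'_continuous.
apply: eq_Rintegral => x /set_mem /=; rewrite in_itv /= => xr.
rewrite /v /v' exprS; move: (s x) ((a - x)^-1 ^+ n) => S V.
by field; rewrite !gt_eqF ?spectrum_lt ?spectrum_gt.
Qed.

Let w_derive (x : R) : is_derive x 1 w (- (2 * x)).
Proof.
apply: is_derive_eq.
by rewrite /GRing.scale /=; ring.
Qed.

Let s_derive (x : R) : - r < x < r -> is_derive x 1 s (- x / s x).
Proof.
move=> xr; have w0 := w_gt0 xr.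
have s0 : s x != 0 by rewrite gt_eqF // sqrtr_gt0.
have d := is_derive1_comp (is_derive1_sqrt w0) (w_derive x).
by apply: (is_derive_eq d); rewrite -/(s x); field.
Qed.

Let v_derive (x : R) : - r < x < r -> is_derive x 1 v (v x ^+ 2).
Proof.
move=> /andP[x1 x2]; have h : a - x != 0 by rewrite gt_eqF // spectrum_lt // !ltW.
have d : is_derive x 1 (fun y => a - y) (-1).
  by apply: is_derive_eq; ring.
have dv : is_derive x 1 v _ := @is_deriveV R (fun y => a - y) x (-1) 1 h d.
apply: (is_derive_eq dv).
by rewrite /v exprVn scalerN scaleNr opprK /GRing.scale /= mulr1.
Qed.

Let vX_derive n (x : R) : - r < x < r ->
  is_derive x 1 (fun y => v y ^+ n.+1) (n.+1%:R * v x ^+ n.+2).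
Proof.
move=> xr; have dv := v_derive xr.
have : is_derive x 1 (v ^+ n.+1) _ := is_deriveX n.+1 dv.
rewrite exprfctE => dX; apply: (is_derive_eq dX).
by rewrite /GRing.scale /= -mulrA -exprD addn2.
Qed.

(** [w^(3/2) v^(m+1)] vanishes at both ends of the segment, so its derivative
integrates to [0]; in terms of [a - x] one has
[w x = - p^2 + 2 a (a - x) - (a - x)^2], which turns this derivative into a
combination of three consecutive integrands. *)
Lemma resolvent_integral_rec m :
  m.+1%:R * p ^+ 2 * resolvent_integral m.+2 =
  (2 * m%:R - 1) * a * resolvent_integral m.+1 + (2 - m%:R) * resolvent_integral m.
Proof.
pose F x := w x * s x * v x ^+ m.+1.
pose f n x := s x * v x ^+ n.
pose c2 := m.+1%:R * p ^+ 2; pose c1 := (2 * m%:R - 1) * a.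
pose c0 : R := 2 - m%:R.
pose g x := c2 * f m.+2 x - (c1 * f m.+1 x + c0 * f m x).
have cf n k : {within `[- r, r], continuous (fun x => k * f n x)}.
  apply: within => x xr; apply: cvgM; first exact: cvg_cst.
  by apply: cvgM; [exact: s_continuous|exact: vX_continuous].
have int n k : mu.-integrable `[- r, r] (EFin \o (fun x => k * f n x)).
  exact: integrable_continuous.
have cD : {within `[- r, r], continuous (fun x => c1 * f m.+1 x + c0 * f m x)}.
  exact: within_continuousD (cf _ _) (cf _ _).
have cg : {within `[- r, r], continuous g}.
  exact: within_continuousB (cf _ _) cD.
have g0 : \int[mu]_(x in `[- r, r]) g x = 0.
  have wr : w r = 0 by rewrite /w rr subrr.
  have wNr : w (- r) = 0 by rewrite /w sqrrN rr subrr.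
  have -> : \int[mu]_(x in `[- r, r]) g x = - F r - - F (- r); last first.
    by rewrite /F wr wNr !mul0r subrr.
  apply: (@Rintegral_FTC _ _ _ rNr g (fun x => - F x) cg).
  - apply: within => x xr; apply: cvgN; apply: cvgM; last exact: vX_continuous.
    by apply: cvgM; [exact: w_continuous|exact: s_continuous].
  - move=> x xr.
    have h : a - x != 0 by rewrite gt_eqF // spectrum_lt //; case/andP: xr => *; rewrite !ltW.
    have s0 : s x != 0 by rewrite gt_eqF // sqrtr_gt0 w_gt0.
    have sw : w x = s x ^+ 2 by rewrite sqr_sqrtr // ltW // w_gt0.
    have dw := w_derive x; have ds := s_derive xr; have dv := vX_derive m xr.
    have dF : is_derive x 1 (fun y => - F y) _ :=
      is_deriveN (is_deriveM (is_deriveM dw ds) dv).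
    apply: (is_derive_eq dF).
    rewrite /g /f /GRing.scale /= sw.
    have -> : (w * s) x = s x ^+ 2 * s x by rewrite -sw.
    have -> : s x ^+ 2 * (- x / s x) = - x * s x by field.
    rewrite -sw /w !exprS /c2 /c1 /c0 /v /a /p.
    by move: (s x) ((a - x)^-1 ^+ m) => S V; field.
have int1 : mu.-integrable `[- r, r] (EFin \o (fun x => c1 * f m.+1 x + c0 * f m x)).
  exact: integrable_continuous.
have int0 n : mu.-integrable `[- r, r] (EFin \o f n).
  by apply: integrable_continuous => //; exact: sv_continuous.
have : \int[mu]_(x in `[- r, r]) g x = c2 * resolvent_integral m.+2 -
    (c1 * resolvent_integral m.+1 + c0 * resolvent_integral m).
  rewrite /g (@RintegralB _ _ _ mu _ (fun x => c2 * f m.+2 x)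
    (fun x => c1 * f m.+1 x + c0 * f m x)) //.
  rewrite (@RintegralD _ _ _ mu _ (fun x => c1 * f m.+1 x) (fun x => c0 * f m x)) //.
  by rewrite !RintegralZl.
by rewrite g0 => /esym/eqP; rewrite subr_eq0 => /eqP.
Qed.

Let s_gt0 x : - r < x < r -> 0 < s x.
Proof. by move=> xr; rewrite sqrtr_gt0 w_gt0. Qed.

Let sE x : - r < x < r -> s x ^+ 2 = r ^+ 2 - x ^+ 2.
Proof. by move=> xr; rewrite sqr_sqrtr ?ltW ?w_gt0 // rr. Qed.

Let sr : s r = 0.
Proof. by rewrite /s /w rr subrr sqrtr0. Qed.

Let sNr : s (- r) = 0.
Proof. by rewrite /s /w sqrrN rr subrr sqrtr0. Qed.

Let r0 : r != 0. Proof. by rewrite gt_eqF. Qed.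

Let arc x := asin (x / r).

Let arc_continuous : {within `[- r, r], continuous arc}.
Proof.
apply: continuous_asin_comp => //.
  by apply: within => x xr; apply: cvgM; [exact: cvg_id|exact: cvg_cst].
by move=> x /andP[x1 x2]; rewrite ler_pdivrMr // ler_pdivlMr // mulN1r mul1r x1.
Qed.

Let arc_derive x : - r < x < r -> is_derive x 1 arc (s x)^-1.
Proof.
move=> xr; have s0 := s_gt0 xr.
have d : is_derive x 1 (fun y : R => y / r) r^-1.
  have d : is_derive x 1 (fun y : R => y * (cst r^-1 y)) _ :=
    is_deriveM (is_derive_id x 1) (is_derive_cst r^-1 x 1).
  by apply: (is_derive_eq d); rewrite /GRing.scale /=; ring.
have k0 : 0 < s x / r by rewrite divr_gt0.
have e : 1 - (x / r) ^+ 2 = (s x / r) ^+ 2.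
  by rewrite !expr_div_n sE //; field.
apply: (is_derive_eq (is_derive_asin_comp d k0 e)).
by field; rewrite r0 gt_eqF.
Qed.

Lemma resolvent_integral0 : resolvent_integral 0 = 2 * pi * q.
Proof.
pose F x := (x * s x + r ^+ 2 * arc x) / 2.
have -> : resolvent_integral 0 = F r - F (- r).
  apply: (@Rintegral_FTC _ _ _ rNr (fun x => s x * v x ^+ 0%N) F (@sv_continuous 0%N)).
  - have cx : {within `[- r, r], continuous (@id R)}.
      by apply: (@within id) => x _; exact: cvg_id.
    move=> x; apply: cvgM; last exact: cst_within.
    apply: cvgD; apply: cvgM; [exact: cx|exact: s_within|exact: cst_within|exact: arc_continuous].
  - move=> x xr; have s0 := s_gt0 xr.
    have d : is_derive x 1 (fun y => (y * s y + cst (r ^+ 2) y * arc y) * cst 2^-1 y) _ :=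
      is_deriveM (is_deriveD (is_deriveM (is_derive_id x 1) (s_derive xr))
        (is_deriveM (is_derive_cst (r ^+ 2) x 1) (arc_derive xr)))
        (is_derive_cst (2^-1 : R) x 1).
    apply: (is_derive_eq d); rewrite /GRing.scale /= expr0 !mulr0 !addr0 add0r.
    rewrite (_ : r ^+ 2 = s x ^+ 2 + x ^+ 2); last by rewrite sE // subrK.
    by field; rewrite gt_eqF.
by rewrite /F sr sNr /arc [- r / r]mulNr divff // asin1 asinN1 rr; field.
Qed.

(* A primitive of sqrt (r^2 - x^2) / (a - x): divide by the square root and write
   (r^2 - x^2) / (a - x) = - p^2 / (a - x) + a + x, where p^2 = a^2 - r^2.  The
   function inner is the homography that sends -r to -1, r to 1 and a to infinity;
   its arcsine is a primitive of p / ((a - x) sqrt (r^2 - x^2)). *)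
Let num x := a * x - r ^+ 2.
Let inner x := num x / r * v x.
Let primitive x := - p * asin (inner x) + a * arc x - s x.

Let p2 : p ^+ 2 = a ^+ 2 - r ^+ 2.
Proof. by rewrite rr /p /a; ring. Qed.

Let inner_bounds x : - r <= x <= r -> -1 <= inner x <= 1.
Proof.
move=> xr; have h := spectrum_lt xr; case/andP: xr => x1 x2; have := r_lt_a => ra.
have k0 : 0 < r * (a - x) by rewrite mulr_gt0.
have -> : inner x = num x / (r * (a - x)).
  by rewrite /inner /v; field; rewrite r0 gt_eqF.
by rewrite ler_pdivrMr // ler_pdivlMr // /num; apply/andP; split; nra.
Qed.

Let primitive_continuous : {within `[- r, r], continuous primitive}.
Proof.
have ci : {within `[- r, r], continuous (fun x => asin (inner x))}.
  apply: continuous_asin_comp => //; apply: within => x xr.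
  apply: cvgM; last exact: v_continuous.
  apply: cvgM; last exact: cvg_cst.
  apply: cvgB; last exact: cvg_cst.
  by apply: cvgM; [exact: cvg_cst|exact: cvg_id].
move=> x; apply: cvgB; last exact: s_within.
by apply: cvgD; apply: cvgM; [exact: cst_within|exact: ci|exact: cst_within|exact: arc_continuous].
Qed.

Let primitive_derive x : - r < x < r -> is_derive x 1 primitive (s x * v x).
Proof.
move=> xr; have s0 := s_gt0 xr.
have h : 0 < a - x by apply: spectrum_lt; case/andP: xr => *; rewrite !ltW.
have dn : is_derive x 1 (fun y => (cst a y * y - cst (r ^+ 2) y) * cst r^-1 y * v y) _ :=
  is_deriveM (is_deriveM (is_deriveB (is_deriveM (is_derive_cst a x 1) (is_derive_id x 1))
    (is_derive_cst (r ^+ 2) x 1)) (is_derive_cst r^-1 x 1)) (v_derive xr).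
have di : is_derive x 1 inner (p ^+ 2 / (r * (a - x) ^+ 2)).
  apply: (is_derive_eq dn); rewrite /GRing.scale /= p2 /v !mulr0.
  rewrite [X in X * _ + _](_ : _ = num x / r) // /num.
  by field; rewrite r0 gt_eqF.
have k0 : 0 < p * s x / (r * (a - x)) by apply: divr_gt0; apply: mulr_gt0.
have e : 1 - inner x ^+ 2 = (p * s x / (r * (a - x))) ^+ 2.
  rewrite [RHS]expr_div_n [(p * s x) ^+ 2]exprMn sE // p2 /inner /num /v.
  by field; rewrite r0 gt_eqF.
have d : is_derive x 1 (fun y => cst (- p) y * asin (inner y) + cst a y * arc y - s y) _ :=
  is_deriveB (is_deriveD (is_deriveM (is_derive_cst (- p) x 1) (is_derive_asin_comp di k0 e))
    (is_deriveM (is_derive_cst a x 1) (arc_derive xr))) (s_derive xr).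
apply: (is_derive_eq d); rewrite /GRing.scale /= !mulr0 !addr0.
apply: (mulIf (x := s x * (a - x))); first by rewrite mulf_neq0 ?gt_eqF.
transitivity (s x ^+ 2); last by rewrite /v; field; rewrite gt_eqF.
rewrite sE //; transitivity ((a + x) * (a - x) - p ^+ 2); last by rewrite p2; ring.
by field; rewrite r0 !gt_eqF // p_gt0.
Qed.

Let primitive_r : primitive r = pi.
Proof.
have h : a - r != 0 by rewrite subr_eq0 gt_eqF // r_lt_a.
have e : inner r = 1 by rewrite /inner /num /v; field; rewrite h r0.
by rewrite /primitive e /arc divff // asin1 sr /a /p; field.
Qed.

Let primitive_Nr : primitive (- r) = - pi.
Proof.
have h : a + r != 0 by rewrite gt_eqF // addr_gt0 // (lt_trans _ r_lt_a).
have e : inner (- r) = -1 by rewrite /inner /num /v opprK; field; rewrite h r0.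
by rewrite /primitive e /arc [- r / r]mulNr divff // asinN1 sNr /a /p; field.
Qed.

Lemma resolvent_integral1 : resolvent_integral 1 = 2 * pi.
Proof.
have -> : resolvent_integral 1 = primitive r - primitive (- r).
  apply: (@Rintegral_FTC _ _ _ rNr (fun x => s x * v x ^+ 1%N) primitive (@sv_continuous 1%N)).
  - exact: primitive_continuous.
  - exact: primitive_derive.
by rewrite primitive_r primitive_Nr; ring.
Qed.

(** The reflection [x |-> - x] of the previous integral. *)
Lemma mixed_integral0 : mixed_integral 0 = 2 * pi.
Proof.
have -> : mixed_integral 0 = - primitive (- r) - - primitive (- - r).
  apply: (@Rintegral_FTC _ _ _ rNr (fun x => s x * v x ^+ 0 * v' x)
    (fun x => - primitive (- x)) (@svv'_continuous 0%N)).
  - move=> x; apply: cvgN.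
    by have := @within_continuous_compN R R R primitive (- r) r; rewrite opprK; apply.
  - move=> x xr; have xr' : - r < - x < r by move: xr; lra.
    have d : is_derive x 1 (fun y => - primitive (- y)) _ :=
      is_deriveN (is_derive1_comp (primitive_derive xr') (is_deriveNid x 1)).
    apply: (is_derive_eq d).
    by rewrite /s /w /v /v' sqrrN opprK expr0; ring.
by rewrite !opprK primitive_r primitive_Nr; ring.
Qed.

End SemicircleIntegrals.

(** * The zeta function at positive integers *)

Section Zeta.
Local Open Scope complex_scope.

Lemma cpow_nat (R : realType) (x : R) (n : nat) : 0 < x ->
  cpow x (- (n%:R : R[i])) = (x^-1 ^+ n)%:C.
Proof.
move=> x0; rewrite /cpow.
have -> : - (n%:R : R[i]) * (ln x)%:C = (- (n%:R * ln x))%:C.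
  by rewrite rmorphN rmorphM rmorph_nat mulNr.
rewrite /cexp /= cos0 sin0 expRN expRM_natl lnK ?posrE // exprVn.
by rewrite -[1 +i* 0]/(1 : R[i]) mulr1.
Qed.

Lemma zeta_mixed_integral (R : realType) (q n : nat) : (2 <= q)%N ->
  zeta q (n%:R : R[i]) =
    ((q%:R + 1) * (mixed_integral q%:R n.+1 / (2 * pi)))%:C.
Proof.
move=> q2; have q1 : 1 < q%:R :> R by rewrite ltr1n.
rewrite /zeta; set D := `[_, _]%classic.
set f := fun lam : R => _.
have fE : {in D, forall x, f x = (Num.sqrt (4 * q%:R - x ^+ 2) *
    (q%:R + 1 - x)^-1 ^+ n.+1 * (q%:R + 1 + x)^-1)%:C}.
  move=> x /set_mem; rewrite /D /= in_itv /= => xr.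
  have h1 := spectrum_lt q1 xr.
  have h2 := spectrum_gt q1 xr.
  rewrite /f cpow_nat // -rmorphM /=; congr (_%:C).
  rewrite subr_sqr [_^-1 ^+ n.+1]exprS; move: (_^-1 ^+ n) (Num.sqrt _) => V S.
  by field; rewrite !gt_eqF.
rewrite /cintegral.
have -> : \int[lebesgue_measure]_(x in D) complex.Re (f x) = mixed_integral q%:R n.+1.
  by apply: eq_Rintegral => x /fE ->.
have -> : \int[lebesgue_measure]_(x in D) complex.Im (f x) = 0.
  transitivity (\int[lebesgue_measure]_(x in D) (0 : R)).
    by apply: eq_Rintegral => x /fE ->.
  by rewrite /Rintegral integral0.
rewrite -[_ +i* 0]/(_%:C) -rmorphM /=; congr (_%:C).
by rewrite mulrAC mulrA.
Qed.

Lemma zeta_dyck (R : realType) (q m : nat) : (2 <= q)%N ->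
  zeta q (m.+1%:R : R[i]) =
    q%:R / ((q%:R - 1) ^+ (2 * m).+1 * (q%:R + 1) ^+ m.+1)
      * ((dyck_gf ('X : {poly int}) m).[q%:R])%:~R.
Proof.
move=> q2; have q1 : 1 < q%:R :> R by rewrite ltr1n.
have [r Hr] := @dyck_gf_quadratic R q%:R m.+1.
have pi0 : (2 * pi : R) != 0 by rewrite mulf_neq0 ?pnatr_eq0 // gt_eqF // pi_gt0.
have p0 : q%:R - 1 != 0 :> R by rewrite subr_eq0 gt_eqF.
have a0 : q%:R + 1 != 0 :> R by rewrite gt_eqF // addr_gt0 // (lt_trans _ q1).
rewrite zeta_mixed_integral //.
rewrite (@moments_dyck _ _ _ _ _ Hr p0 a0 (fun n => resolvent_integral q%:R n / (2 * pi))
   (fun n => mixed_integral q%:R n / (2 * pi))) //.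
- rewrite coef_poly ltnSn dyck_gf_nat.
  rewrite rmorphM fmorph_div rmorphM !rmorphXn rmorphB rmorphD rmorph1 !rmorph_nat.
  by rewrite rmorph_int.
- by rewrite resolvent_integral0 // mulrAC divff // mul1r.
- by rewrite resolvent_integral1 // divff.
- by rewrite mixed_integral0 // divff.
- by move=> n; rewrite [LHS]mulrA resolvent_integral_rec // mulrDl -!mulrA.
- by move=> n; rewrite mulrA mixed_integralS // mulrDl.
Qed.
End Zeta.

Theorem theorem1p1 (R : realType) (n : nat) (hn : (1 <= n)%N) :
  exists P : {poly int},
    [/\ palindromic P,
        P \is monic,
        size P = (2 * n - 2).+1,
        forall q : nat, (2 <= q)%N ->
          zeta q (n%:R : R[i]) =
            q%:R / ((q%:R - 1) ^+ (2 * n - 1) * (q%:R + 1) ^+ n)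
              * (P.[q%:R])%:~R
      & (forall k : nat, P`_k = (num_dyck2 (n - 1) k)%:Z) /\
        (forall k : nat, 0 <= P`_k)].
Proof.
case: n hn => // m _; exists (dyck_gf 'X m).
have e1 : (2 * m.+1 - 1 = (2 * m).+1)%N by lia.
have e2 : (2 * m.+1 - 2 = 2 * m)%N by lia.
split; rewrite ?e1 ?e2 ?subn1.
- exact: palindromic_dyck_gf.
- exact: monic_dyck_gf.
- exact: size_dyck_gf.
- by move=> q q2; exact: zeta_dyck.
- by split=> k; rewrite coef_dyck_gf.
Qed.
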